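(* Let $V$ be a finite set and let $\mathcal{F}\subseteq 2^V$ be a nonempty family of subsets of $V$. For a multigraph $G$ on $V$, let $g_{\mathcal F}(G)=\max_{S\in\mathcal F}\operatorname{cut}_G(S)$, and for $u,v\in V$ let \[ \Delta^G_{uv}=g_{\mathcal F}(G+uv)-g_{\mathcal F}(G). \] Then, for every multigraph $G$ on $V$, one has $\Delta^G_{uv}\in\{0,1\}$ and $\Delta^G_{uu}=0$ for all $u,v\in V$. Moreover, the symmetric matrix $\Delta^G=(\Delta^G_{uv})_{u,v\in V}$ is conditionally negative semidefinite: for every $z\in\mathbb{R}^V$ satisfying $\sum_{v\in V}z_v=0$, \[ \sum_{u,v\in V}\Delta^G_{uv}z_uz_v\leq 0 . \]
   Context: Multigraphs are finite and undirected, with loops and multiple edges allowed. For a multigraph $G$ on $V$ and $S\subseteq V$, $\operatorname{cut}_G(S)$ is the number of edges with exactly one endpoint in $S$ (multiple edges counted with multiplicity; loops contribute nothing). $G+uv$ is the multigraph obtained from $G$ by adding one edge between $u$ and $v$; when $u=v$ the added edge is a loop. The family $\mathcal F$ is fixed independently of $G$ and need not be closed under complements. *)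

(* Defs.v *)
From HB Require Import structures.
From mathcomp Require Import all_boot all_order all_algebra.
From mathcomp Require Import reals.
Set Implicit Arguments.
Unset Strict Implicit.
Unset Printing Implicit Defensive.
Import Order.TTheory GRing.Theory Num.Theory.
Local Open Scope ring_scope.

(* Edges are abstract, so parallel edges are distinct elements of [edge] with
   the same ends; a loop is an edge with a singleton set of ends. *)
Record multigraph (V : finType) := Multigraph {
  edge : finType;
  ends : edge -> {set V};
  ends_card : forall e, (0 < #|ends e| <= 2)%N
}.

Definition is_loop (V : finType) (G : multigraph V) (e : edge G) : bool :=
  #|ends e| == 1%N.

Definition add_ends (V : finType) (G : multigraph V) (u v : V)
    (e : option (edge G)) : {set V} :=
  if e is Some e' then ends e' else [set u; v].

Lemma add_ends_card (V : finType) (G : multigraph V) (u v : V)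
    (e : option (edge G)) : (0 < #|add_ends u v e| <= 2)%N.
Proof.
case: e => [e|] /=; first exact: ends_card.
by rewrite cards2; case: (u != v).
Qed.

Definition add_edge (V : finType) (G : multigraph V) (u v : V) : multigraph V :=
  Multigraph (@add_ends_card V G u v).

(* A loop at a vertex of S meets S in one vertex but must not be counted. *)
Definition cut (V : finType) (G : multigraph V) (S : {set V}) : nat :=
  #|[set e : edge G | ~~ is_loop e & #|ends e :&: S| == 1%N]|.

Definition maxcut (V : finType) (F : {set {set V}}) (G : multigraph V) : nat :=
  \max_(S in F) cut G S.

(* Integer-valued, so that the subtraction is not truncated. *)
Definition Delta (V : finType) (F : {set {set V}}) (G : multigraph V)
    (u v : V) : int :=
  (maxcut F (add_edge G u v))%:Z - (maxcut F G)%:Z.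

Definition cond_neg_semidef (R : realType) (V : finType) (A : V -> V -> R) :
    Prop :=
  forall z : V -> R, \sum_(v : V) z v = 0 ->
    \sum_(u : V) \sum_(v : V) A u v * z u * z v <= 0.

(* Main.v *)
(* Delta u v is 1 exactly when some maximiser of the cut over F separates u from
   v. Being separated by no maximiser is an equivalence relation, so the
   quadratic form is the square of the sum of z minus the sum, over the classes,
   of the squares of the class sums of z. *)
Require Import Defs.
From HB Require Import structures.
From mathcomp Require Import all_boot all_order all_algebra.
From mathcomp Require Import reals.
Import Order.TTheory GRing.Theory Num.Theory.
Local Open Scope ring_scope.

Lemma sum_option (T : finType) (f : option T -> nat) :
  (\sum_x f x = f None + \sum_x f (Some x))%N.
Proof.
rewrite (bigD1 None) //=; congr addn.
rewrite (reindex_omap Some id) => [|[x|] //].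
by apply: eq_bigl => x; rewrite eqxx.
Qed.

Lemma cut_add_edge (V : finType) (G : multigraph V) (u v : V) (S : {set V}) :
  cut (add_edge G u v) S = (cut G S + ((u \in S) != (v \in S)))%N.
Proof.
have cutE (H : multigraph V) : cut H S =
    (\sum_(e : edge H) (~~ is_loop e && (#|ends e :&: S| == 1%N)))%N.
  by rewrite /cut cardsE -sum1_card big_mkcond; apply: eq_bigr => e _;
    rewrite unfold_in /=; case: ifP.
rewrite !cutE sum_option /= addnC; congr addn.
rewrite /is_loop /= cards2 eqSS eqb0 negbK.
(* If [u = v], the new edge is a loop and counts zero, in agreement with [u] and [v] lying on the
   same side of [S]. *)
have [<-|uv] := eqVneq u v; first by rewrite eqxx.
rewrite setIUl cardsU.
have -> : [set u] :&: S :&: ([set v] :&: S) = set0.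
  apply/setP=> x; rewrite !inE.
  by have [->|] := eqVneq x u; rewrite ?(negPf uv) ?andbF.
have card1I x : #|[set x] :&: S| = (x \in S).
  case: (boolP (x \in S)) => xS; first by rewrite (setIidPl _) ?cards1 ?sub1set.
  by apply/eqP; rewrite cards_eq0 setI_eq0 disjoints1.
by rewrite cards0 subn0 !card1I; do 2 case: (_ \in S).
Qed.

(** This set serves as a label of [u]: two vertices have equal labels exactly when no maximiser
    separates them. The equivalence classes are thus the fibres of a function. *)
Definition max_cuts_at {V : finType} (F : {set {set V}}) (G : multigraph V)
    (u : V) : {set {set V}} :=
  [set S in F | (cut G S == maxcut F G) && (u \in S)].

(** A new edge raises each cut by at most one, so a set that is not a maximiser can at best catch up
    with the old maximum. The maximum grows only through a maximiser that separates [u] from [v]. *)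
Lemma maxcut_add_edge (V : finType) (F : {set {set V}}) (G : multigraph V)
    (u v : V) :
  maxcut F (add_edge G u v) =
  (maxcut F G + (max_cuts_at F G u != max_cuts_at F G v))%N.
Proof.
have le_maxcut H S : S \in F -> (cut H S <= maxcut F H)%N.
  by move=> SF; apply: (leq_bigmax_cond _ SF).
apply/eqP; rewrite eqn_leq; apply/andP; split.
  apply/bigmax_leqP => S SF; rewrite cut_add_edge.
  have := le_maxcut G _ SF; rewrite leq_eqVlt => /orP[/eqP cutS|ltS]; last first.
    apply: leq_trans (leq_addr _ _); apply: leq_trans ltS.
    by rewrite -addn1 leq_add2l leq_b1.
  rewrite cutS leq_add2l.
  have [eq_cuts|_] :=
    eqVneq (max_cuts_at F G u) (max_cuts_at F G v); last exact: leq_b1.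
  have := congr1 (fun A : {set {set V}} => S \in A) eq_cuts.
  by rewrite !inE SF cutS eqxx /= => ->; rewrite eqxx.
have [_|neq] := eqVneq (max_cuts_at F G u) (max_cuts_at F G v).
  rewrite addn0; apply/bigmax_leqP => S SF; apply: leq_trans (le_maxcut _ _ SF).
  by rewrite cut_add_edge leq_addr.
(* Distinct labels differ at some [S]. Such an [S] must be a maximiser in [F], and it contains
   exactly one of [u] and [v]. *)
have [S] : exists S, (S \in max_cuts_at F G u) != (S \in max_cuts_at F G v).
  apply/existsP; apply: contraNT neq; rewrite negb_exists => /forallP same.
  by apply/eqP/setP => S; apply/eqP; have := same S; rewrite negbK.
rewrite !inE; case SF: (S \in F) => //=.
case: (cut G S =P maxcut F G) => //= <- sep; apply: leq_trans (le_maxcut _ _ SF).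
by rewrite cut_add_edge sep.
Qed.

Lemma Delta_max_cuts (V : finType) (F : {set {set V}}) (G : multigraph V)
    (u v : V) :
  Delta F G u v = (max_cuts_at F G u != max_cuts_at F G v)%:R.
Proof. by rewrite /Delta maxcut_add_edge PoszD addrC addKr natz. Qed.

(** The matrix is all-ones minus the indicator of equal labels. The all-ones form vanishes when [z]
    sums to zero, and the indicator form is a sum of squares over the fibres of [f]. *)
Lemma cond_neg_semidef_neq (R : realType) (V T : finType) (f : V -> T) :
  cond_neg_semidef (fun u v => (f u != f v)%:R : R).
Proof.
move=> z z0.
have -> : \sum_u \sum_v (f u != f v)%:R * z u * z v =
    (\sum_u z u) ^+ 2 - \sum_t (\sum_(u | f u == t) z u) ^+ 2.
  have -> : \sum_t (\sum_(u | f u == t) z u) ^+ 2 =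
      \sum_u \sum_(v | f v == f u) z u * z v.
    (* Grouping [u] by its label [t] turns the double sum over equally labelled pairs into one
       square per label. *)
    rewrite [RHS](partition_big f predT) //=; apply: eq_bigr => t _.
    rewrite expr2 mulr_suml; apply: eq_bigr => u /eqP <-.
    by rewrite mulr_sumr.
  rewrite expr2 mulr_suml -sumrB; apply: eq_bigr => u _.
  rewrite mulr_sumr [X in _ - X]big_mkcond -sumrB; apply: eq_bigr => v _.
  by rewrite eq_sym; case: eqP => _; rewrite ?mul0r ?mul1r ?subrr ?subr0.
by rewrite z0 expr0n sub0r oppr_le0 sumr_ge0 // => t _; apply: sqr_ge0.
Qed.

Theorem lemma3p1 (R : realType) (V : finType) (F : {set {set V}})
    (F_nonempty : F != set0) (G : multigraph V) :
  [/\ (forall u v : V, Delta F G u v = 0 \/ Delta F G u v = 1),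
      (forall u : V, Delta F G u u = 0),
      (forall u v : V, Delta F G u v = Delta F G v u) &
      cond_neg_semidef (fun u v : V => (Delta F G u v)%:~R : R)].
Proof.
split=> [u v|u|u v|z z0].
- by rewrite Delta_max_cuts; case: (_ != _); [right|left].
- by rewrite Delta_max_cuts eqxx.
- by rewrite !Delta_max_cuts eq_sym.
rewrite (eq_bigr (fun u => \sum_v
    (max_cuts_at F G u != max_cuts_at F G v)%:R * z u * z v)); last first.
  by move=> u _; apply: eq_bigr => v _; rewrite Delta_max_cuts natz.
exact: cond_neg_semidef_neq.
Qed.
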